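(* Let $E$ be a Banach lattice and let $M$ be a positive uniformly bounded subset of $E$. Suppose that $M$ is totally bounded with respect to $p_M$. Then $(E_M,p_M)$ is an AM-space with order unit if and only if $(E_M,p_M)=\left(E_u,\frac{1}{p_M(u)}\|\cdot\|_u\right)$ for some positive vector $u\in E_M$ (equality of the vector spaces and of the norms).
   Context: All vector spaces are real. $E_+$ denotes the positive cone of an ordered vector space $E$. A norm is monotone if $0\le v\le w$ implies $\|v\|\le\|w\|$. A normed Riesz space is a Riesz space (vector lattice) with a monotone norm; a Banach lattice is a complete normed Riesz space. An AM-space is a Banach lattice with $\|v\vee w\|=\max\{\|v\|,\|w\|\}$ for all positive $v,w$. An order unit is a vector $u\in E_+$ such that for every $v\in E$ there is $t\ge 0$ with $v\le tu$. A positive subset $M$ of $E$ is a non-empty subset of $E_+$; it is required that $0\notin\mathrm{co}(M)$ (convex hull), and $C_M=\{tm : t\ge 0,\ m\in\mathrm{co}(M)\setminus\{0\}\}$. $M$ is uniformly bounded if $\sup\{\|m\|:m\in M\}<\infty$. Define $E_M=\{v\in E : \pm v\le c\text{ for some }c\in C_M\}$ and, for $v\in E_M$, $p_M(v)=\inf\{\sum_{j=1}^n t_j : \pm v\le\sum_{j=1}^n t_jm_j\text{ for some } n\in\mathbf{N},\ t_j\ge 0,\ m_j\in M\}$. For a positive vector $u$, $E_u=E_{\{u\}}$ is the principal ideal generated by $u$ and $\|v\|_u=\inf\{t\ge 0 : \pm v\le tu\}$ is its order unit norm.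
   Formalization: The norm of the Banach lattice E is taken to be a lattice norm, i.e. besides being monotone on the positive cone it satisfies ‖|v|‖ = ‖v‖; with monotonicity on the cone alone the claim is false, since the cone need not be closed and (E_u, ‖·‖_u) need not be complete. *)

(* Defs.v *)
From HB Require Import structures.
From mathcomp Require Import all_boot all_order all_algebra.
From mathcomp Require Import boolp classical_sets functions cardinality reals.
From mathcomp Require Import topology normedtype sequences.

Set Implicit Arguments.
Unset Strict Implicit.
Unset Printing Implicit Defensive.

Import Order.TTheory GRing.Theory Num.Theory.
Import numFieldNormedType.Exports.

Local Open Scope classical_set_scope.
Local Open Scope ring_scope.

HB.mixin Record Lmodule_isOrdered (R : numDomainType) E
    of GRing.Lmodule R E & Order.POrder ring_display E := {
  ordmod_leD2r : forall z x y : E, x <= y -> x + z <= y + z ;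
  ordmod_leZ2l : forall (a : R) (x y : E), 0 <= a -> x <= y -> a *: x <= a *: y
}.

#[short(type="orderedLmodType")]
HB.structure Definition OrderedLmodule (R : numDomainType) :=
  {E of GRing.Lmodule R E & Order.POrder ring_display E
      & Lmodule_isOrdered R E}.

(** The notions below concern a pair (F, p) of a subspace F of an ordered vector
    space E, with the induced order, and a function p giving the norm on F; the
    whole space is the case F = [set: E].  Suprema are taken in F, not in E.
    The norm is not a normedModType structure because E carries an order as
    well: numDomainType already joins an order and a norm, so no structure
    extending both orderedLmodType and normedModType can be declared on top of
    the library's hierarchy. *)
Section NormedRieszSpaces.
Context {R : realType} {E : orderedLmodType R}.
Implicit Types (F : set E) (p : E -> R).

Definition is_join_in F (x y s : E) : Prop :=
  [/\ F s, x <= s, y <= s & forall z, F z -> x <= z -> y <= z -> s <= z].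

(* Meets are obtained from joins by x |-> - x. *)
Record riesz_space_on F : Prop := {
  rso_zero : F 0 ;
  rso_linear : forall (a : R) x y, F x -> F y -> F (a *: x + y) ;
  rso_join : forall x y, F x -> F y -> exists s, is_join_in F x y s
}.

Record norm_on F p : Prop := {
  no_triangle : forall x y, F x -> F y -> p (x + y) <= p x + p y ;
  no_homogeneous : forall (a : R) x, F x -> p (a *: x) = `|a| * p x ;
  no_definite : forall x, F x -> p x = 0 -> x = 0
}.

Definition complete_on F p : Prop :=
  forall x_ : nat -> E, (forall n, F (x_ n)) ->
    (forall e : R, 0 < e -> exists N, forall m n, (N <= m)%N -> (N <= n)%N ->
       p (x_ m - x_ n) < e) ->
    exists2 l, F l & p (x_ n - l) @[n --> \oo] --> (0 : R).

(* The clauses on monotonicity and on the absolute value |x| (the join of x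
   and - x) together say that p is a lattice norm: |x| <= |y| implies
   p x <= p y.  Monotonicity on the positive cone alone would allow complete
   norms for which the positive cone is not closed. *)
Record banach_lattice_on F p : Prop := {
  blo_riesz : riesz_space_on F ;
  blo_norm : norm_on F p ;
  blo_monotone : forall x y, F x -> F y -> 0 <= x -> x <= y -> p x <= p y ;
  blo_abs : forall x s, F x -> is_join_in F x (- x) s -> p s = p x ;
  blo_complete : complete_on F p
}.

Record am_space_on F p : Prop := {
  am_banach_lattice : banach_lattice_on F p ;
  am_max : forall x y s, F x -> F y -> 0 <= x -> 0 <= y ->
    is_join_in F x y s -> p s = Num.max (p x) (p y)
}.

Definition is_order_unit_on F (u : E) : Prop :=
  [/\ F u, 0 <= u
    & forall v, F v -> exists2 t : R, 0 <= t & v <= t *: u].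

Definition uniformly_bounded p (A : set E) : Prop :=
  has_ubound [set p x | x in A].

(* The covering balls are those of the normed space (F, p). *)
Definition totally_bounded_on F p (A : set E) : Prop :=
  forall e : R, 0 < e -> exists C : set E,
    [/\ finite_set C, C `<=` F
      & forall x, A x -> exists2 c, C c & p (x - c) < e].

End NormedRieszSpaces.

Section GeneratedSpace.
Context {R : realType} {E : orderedLmodType R}.
Implicit Types (M : set E) (u v : E).

Definition convex_hull M : set E :=
  [set x | exists (n : nat) (t : 'I_n -> R) (m : 'I_n -> E),
    [/\ forall i, 0 <= t i, \sum_(i < n) t i = 1, forall i, M (m i)
      & x = \sum_(i < n) t i *: m i]].

Definition positive_subset M : Prop :=
  [/\ M !=set0, forall m, M m -> 0 <= m & ~ convex_hull M 0].

(* C_M *)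
Definition generated_cone M : set E :=
  [set c | exists (t : R) (m : E),
    [/\ 0 <= t, convex_hull M m, m <> 0 & c = t *: m]].

(* E_M *)
Definition generated_space M : set E :=
  [set v | exists2 c, generated_cone M c & v <= c /\ - v <= c].

(* p_M *)
Definition generated_norm M v : R :=
  inf [set r | exists (n : nat) (t : 'I_n -> R) (m : 'I_n -> E),
    [/\ forall j, 0 <= t j, forall j, M (m j),
        v <= \sum_(j < n) t j *: m j, - v <= \sum_(j < n) t j *: m j
      & r = \sum_(j < n) t j]].

(* E_u *)
Definition principal_ideal u : set E := generated_space [set u].

Definition order_unit_norm u v : R :=
  inf [set t : R | [/\ 0 <= t, v <= t *: u & - v <= t *: u]].

End GeneratedSpace.

(* Main.v *)
Require Import Defs.
From mathcomp Require Import all_boot all_order all_algebra.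
From mathcomp Require Import boolp classical_sets reals.
From mathcomp Require Import cardinality topology normedtype sequences.
From mathcomp Require Import lra.

Set Implicit Arguments.
Unset Strict Implicit.
Unset Printing Implicit Defensive.

Import Order.TTheory GRing.Theory Num.Theory.
Import numFieldNormedType.Exports.

Local Open Scope classical_set_scope.
Local Open Scope ring_scope.

(** Write p for p_M.

    Suppose that (E_M, p) is an AM-space.  Since p m <= 1 for m in M, finite
    suprema of elements of M also have norm at most 1.  Taking suprema of finer
    and finer finite nets of M gives a Cauchy sequence, because refining the net
    moves the supremum by no more than the mesh: an element of M is its nearest
    net point plus an error of small norm, and by the AM property a supremum of
    finitely many such errors is no larger than the largest of them.  The limit u
    is an upper bound of M with p u <= 1 ([am_totally_bounded_majorant]).  Then
    every dominating combination of elements of M with coefficient sum T is at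
    most T u, so ||v||_u <= p v; and |v| <= ||v||_u u gives
    p v <= p u * ||v||_u.  At v = u these two bounds force p u = 1, hence
    p = ||.||_u.

    Conversely, (E_u, ||.||_u) is an AM-space with order unit u whenever u > 0
    ([am_space_order_unit_norm]).  The cone of a Banach lattice is closed, so the
    infimum defining ||v||_u is attained; the algebraic properties follow from
    that.  For completeness, a ||.||_u-Cauchy sequence converges in E, and its
    order bounds pass to the limit.  A positive multiple of an AM-norm is an
    AM-norm, and the factor 1 / p u is positive because boundedness of M yields
    normE <= B p ([norm_le_generated_norm]), which keeps p u away from 0. *)

(** * Ordered modules *)

Section OrderedModules.
Context {R : realType} {E : orderedLmodType R}.
Implicit Types (x y z w u : E) (a s t : R).

Lemma ordmod_leD {x y z w} : x <= y -> z <= w -> x + z <= y + w.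
Proof.
move=> xy zw; apply: le_trans (ordmod_leD2r z _ _ xy) _.
by rewrite ![y + _]addrC; exact: ordmod_leD2r.
Qed.

Lemma ordmod_lerBlDr {x y z} : (x - z <= y) = (x <= y + z).
Proof.
apply/idP/idP => [/(ordmod_leD2r z)|/(ordmod_leD2r (- z))].
  by rewrite subrK.
by rewrite addrK.
Qed.

Lemma ordmod_subr_ge0 {x y} : (0 <= y - x) = (x <= y).
Proof.
apply/idP/idP => [/(ordmod_leD2r x)|/(ordmod_leD2r (- x))].
  by rewrite add0r subrK.
by rewrite subrr.
Qed.

Lemma ordmod_leN2 {x y} : (- x <= - y) = (y <= x).
Proof. by rewrite -[LHS]ordmod_subr_ge0 opprK addrC ordmod_subr_ge0. Qed.

Lemma ordmod_scale_ge0 {a x} : 0 <= a -> 0 <= x -> 0 <= a *: x.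
Proof. by move=> a0 x0; rewrite -(scaler0 _ a); exact: ordmod_leZ2l. Qed.

Lemma ordmod_leZ2r {u s t} : 0 <= u -> s <= t -> s *: u <= t *: u.
Proof.
move=> u0 st; rewrite -ordmod_subr_ge0 -scalerBl.
by apply: ordmod_scale_ge0 => //; rewrite subr_ge0.
Qed.

Lemma ordmod_sum_le (n : nat) (f g : 'I_n -> E) :
  (forall i, f i <= g i) -> \sum_(i < n) f i <= \sum_(i < n) g i.
Proof. by move=> fg; apply: (big_ind2 (fun x y => x <= y)) => // *; exact: ordmod_leD. Qed.

(** Twice [y] dominates the sum of [x] and [- x]. *)
Lemma ordmod_majorant_ge0 {x y} : x <= y -> - x <= y -> 0 <= y.
Proof.
move=> xy Nxy; have := ordmod_leD xy Nxy; rewrite subrr => y2.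
suff -> : y = 2^-1 *: (y + y) by apply: ordmod_scale_ge0; rewrite ?invr_ge0 ?ler0n.
by rewrite -mulr2n -(scaler_nat 2 y) scalerA mulVf ?scale1r ?pnatr_eq0.
Qed.

Lemma ordmod_opp_le {x} : 0 <= x -> - x <= x.
Proof. by move=> x0; rewrite (le_trans _ x0) // -ordmod_leN2 opprK oppr0. Qed.

End OrderedModules.

(** * Order and convergence in a Banach lattice *)

Section BanachLattices.
Context {R : realType} {E : orderedLmodType R}.
Variables (F : set E) (p : E -> R).
Hypothesis FpB : banach_lattice_on F p.
Implicit Types (x y l c u w : E).

Let F0 : F 0 := rso_zero (blo_riesz FpB).

Lemma bl_scale a x : F x -> F (a *: x).
Proof. by move=> Fx; rewrite -[_ *: x]addr0; apply: (rso_linear (blo_riesz FpB)). Qed.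

Lemma bl_add x y : F x -> F y -> F (x + y).
Proof. by move=> Fx Fy; rewrite -[x]scale1r; apply: (rso_linear (blo_riesz FpB)). Qed.

Lemma bl_opp x : F x -> F (- x).
Proof. by move=> Fx; rewrite -scaleN1r; exact: bl_scale. Qed.

Lemma bl_sub x y : F x -> F y -> F (x - y).
Proof. by move=> Fx Fy; apply: bl_add => //; exact: bl_opp. Qed.

Lemma bl_norm0 : p 0 = 0.
Proof. by rewrite -[0 in LHS](scale0r (0 : E)) (no_homogeneous (blo_norm FpB)) // normr0 mul0r. Qed.

Lemma bl_normN x : F x -> p (- x) = p x.
Proof. by move=> Fx; rewrite -scaleN1r (no_homogeneous (blo_norm FpB)) // normrN normr1 mul1r. Qed.

Lemma bl_norm_ge0 x : F x -> 0 <= p x.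
Proof.
move=> Fx; have := no_triangle (blo_norm FpB) Fx (bl_opp Fx).
by rewrite subrr bl_norm0 bl_normN // => ?; lra.
Qed.

Lemma bl_norm_gt0 x : F x -> 0 < x -> 0 < p x.
Proof.
move=> Fx x0; rewrite lt_neqAle bl_norm_ge0 // andbT eq_sym; apply/eqP.
by move=> /(no_definite (blo_norm FpB) Fx) xE; rewrite xE ltxx in x0.
Qed.

Lemma bl_distrC x y : F x -> F y -> p (x - y) = p (y - x).
Proof. by move=> Fx Fy; rewrite -opprB bl_normN //; exact: bl_sub. Qed.

Lemma bl_absolute_value x : F x ->
  exists s, [/\ F s, 0 <= s, x <= s, p s = p x & is_join_in F x (- x) s].
Proof.
move=> Fx; have [s js] := rso_join (blo_riesz FpB) Fx (bl_opp Fx).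
have [Fs xs Nxs _] := js; exists s; split=> //.
  exact: ordmod_majorant_ge0 xs Nxs.
exact: (blo_abs FpB Fx).
Qed.

Lemma bl_norm_le x w : F x -> F w -> x <= w -> - x <= w -> p x <= p w.
Proof.
move=> Fx Fw xw Nxw; have [s [Fs s0 _ <- [_ _ _ smin]]] := bl_absolute_value Fx.
by apply: (blo_monotone FpB) => //; exact: smin.
Qed.

(** The positive cone is closed, in the form used for every passage to the limit
    below: [w] majorizes the positive part of [x] after taking its absolute
    value, so the positive part has arbitrarily small norm and vanishes. *)
Lemma bl_le0_approx x : F x ->
  (forall e : R, 0 < e -> exists w, [/\ F w, x <= w & p w <= e]) -> x <= 0.
Proof.
move=> Fx small; have [s [Fs xs s0 smin]] := rso_join (blo_riesz FpB) Fx F0.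
suff -> : 0 = s by [].
apply/esym/(no_definite (blo_norm FpB)) => //.
apply/eqP; rewrite eq_le bl_norm_ge0 // andbT.
apply/ler_addgt0Pl => e /small[w [Fw xw pw]]; rewrite addr0.
have [a [Fa a0 wa paw _]] := bl_absolute_value Fw.
rewrite (le_trans _ pw) // -paw; apply: (blo_monotone FpB) => //.
by apply: smin => //; exact: le_trans wa.
Qed.

Lemma bl_archimedean x u : F x -> F u ->
  (forall e : R, 0 < e -> x <= e *: u) -> x <= 0.
Proof.
move=> Fx Fu xu; apply: bl_le0_approx => // e e0.
have pu0 := bl_norm_ge0 Fu; have d0 : 0 < p u + 1 by lra.
have k0 : 0 < e / (p u + 1) by exact: divr_gt0.
exists ((e / (p u + 1)) *: u); split; [exact: bl_scale|exact: xu|].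
rewrite (no_homogeneous (blo_norm FpB)) // gtr0_norm // mulrAC ler_pdivrMr //.
by rewrite ler_pM2l //; lra.
Qed.

Definition converges_to (x_ : nat -> E) l : Prop :=
  forall e : R, 0 < e -> exists N, forall n, (N <= n)%N -> p (x_ n - l) <= e.

Lemma bl_limit (x_ : nat -> E) : (forall n, F (x_ n)) ->
  (forall e : R, 0 < e -> exists N, forall m n, (N <= m)%N -> (N <= n)%N ->
     p (x_ m - x_ n) < e) ->
  exists2 l, F l & converges_to x_ l.
Proof.
move=> Fx /(blo_complete FpB Fx)[l Fl xl]; exists l => // e e0.
have [N _ HN] := cvgr0_norm_le _ xl e e0; exists N => n Nn.
exact: le_trans (ler_norm _) (HN n Nn).
Qed.

Lemma bl_limit_le (x_ : nat -> E) l c N : (forall n, F (x_ n)) -> F l -> F c ->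
  converges_to x_ l -> (forall n, (N <= n)%N -> x_ n <= c) -> l <= c.
Proof.
move=> Fx Fl Fc xl xc; rewrite -ordmod_subr_ge0 -ordmod_leN2 oppr0 opprB.
apply: bl_le0_approx; first exact: bl_sub.
move=> e /xl[N' N'e]; pose n := maxn N N'.
exists (l - x_ n); split; first exact: bl_sub.
  by apply: ordmod_leD => //; rewrite ordmod_leN2 xc // leq_maxl.
by rewrite bl_distrC // N'e // leq_maxr.
Qed.

Lemma bl_limit_ge (x_ : nat -> E) l c N : (forall n, F (x_ n)) -> F l -> F c ->
  converges_to x_ l -> (forall n, (N <= n)%N -> c <= x_ n) -> c <= l.
Proof.
move=> Fx Fl Fc xl xc; rewrite -ordmod_subr_ge0 -ordmod_leN2 oppr0 opprB.
apply: bl_le0_approx; first exact: bl_sub.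
move=> e /xl[N' N'e]; pose n := maxn N N'.
exists (x_ n - l); split; first exact: bl_sub.
  by apply: ordmod_leD2r; rewrite xc // leq_maxl.
by rewrite N'e // leq_maxr.
Qed.

End BanachLattices.

(** * Majorants of totally bounded sets in an AM-space *)
Section TotallyBoundedSets.
Context {R : realType} {E : orderedLmodType R}.
Variables (F : set E) (p : E -> R).
Hypothesis FpAM : am_space_on F p.
Let FpB := am_banach_lattice FpAM.
Implicit Types (x y s u w : E) (A : set E).

(** The centers of the given covering need not lie in [A]; replacing each useful
    center by a nearby point of [A] doubles the radius, hence the [e / 2]. *)
Lemma totally_bounded_net A (e : R) : A `<=` F -> totally_bounded_on F p A ->
  0 < e -> exists l : seq E, (forall c, c \in l -> A c) /\
    forall x, A x -> exists2 c, c \in l & p (x - c) <= e.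
Proof.
move=> AF tbA e0; have [C [/finite_seqP[l ->] lF Al]] := tbA _ (divr_gt0 e0 (ltr0Sn _ 1)).
have [f fP] : {f : E -> E & forall c x, A x -> p (x - c) < e / 2 ->
    A (f c) /\ p (f c - c) < e / 2}.
  apply: (@choice _ _ (fun c y => forall x, A x -> p (x - c) < e / 2 ->
    A y /\ p (y - c) < e / 2)) => c.
  have [[y [Ay yc]]|noy] := pselect (exists y, A y /\ p (y - c) < e / 2).
    by exists y.
  (* No point of [A] is near [c], so any value will do. *)
  by exists 0 => x Ax xc; case: noy; exists x.
exists [seq f c | c <- l & `[< A (f c) >]]; split.
  by move=> _ /mapP[c + ->]; rewrite mem_filter => /andP[/asboolP].
move=> x Ax; have [c lc xc] := Al x Ax; have [Afc fcc] := fP c x Ax xc.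
exists (f c).
  by apply: map_f; rewrite mem_filter; apply/andP; split=> //; apply/asboolP.
have [Fx Fc Ff] : [/\ F x, F c & F (f c)] by split; [exact: AF|exact: lF|exact: AF].
rewrite -(subrKA c).
apply: le_trans (no_triangle (blo_norm FpB) (bl_sub FpB Fx Fc) (bl_sub FpB Fc Ff)) _.
by rewrite (bl_distrC FpB Fc) //; lra.
Qed.

(** The supremum of [s] and the entries of [l].  It exceeds [s] by at most the
    supremum of the errors [w], and the AM property bounds the norm of that
    supremum by [e] however long [l] is; the triangle inequality alone would give
    a bound growing with the size of [l]. *)
Lemma am_finite_majorant (K e : R) s (l : seq E) :
  F s -> 0 <= s -> p s <= K -> 0 <= e ->
  (forall c, c \in l -> [/\ F c, 0 <= c, p c <= K
     & exists w, [/\ F w, p w <= e & c <= s + w]]) ->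
  exists s', [/\ F s', s <= s', p s' <= K & forall c, c \in l -> c <= s'] /\
    exists w, [/\ F w, 0 <= w, p w <= e & s' <= s + w].
Proof.
move=> Fs s0 psK e0; elim: l => [|c l IHl] lP.
  exists s; split; first by split.
  exists 0; split=> //; rewrite ?addr0 ?(bl_norm0 FpB) //.
  exact: rso_zero (blo_riesz FpB).
have [d dl|s' [[Fs' ss' ps' ls'] [w [Fw w0 pw s'w]]]] := IHl.
  by apply: lP; rewrite inE dl orbT.
have [Fc c0 pc [v [Fv pv cv]]] := lP c (mem_head _ _).
have [a [Fa a0 va pa _]] := bl_absolute_value FpB Fv.
have [j jP] := rso_join (blo_riesz FpB) Fs' Fc.
have [b bP] := rso_join (blo_riesz FpB) Fw Fa.
have [Fj s'j cj jmin] := jP; have [Fb wb ab _] := bP.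
exists j; split.
  split=> //; first exact: le_trans s'j.
  - rewrite (am_max FpAM Fs' Fc _ c0 jP) ?ge_max ?ps' //.
    exact: le_trans ss'.
  - move=> d; rewrite inE => /orP[/eqP->//|/ls' /le_trans]; exact.
exists b; split=> //; first exact: le_trans wb.
  by rewrite (am_max FpAM Fw Fa w0 a0 bP) ge_max pw pa.
apply: jmin; first exact: (bl_add FpB).
  by apply: le_trans s'w _; exact: ordmod_leD.
by apply: le_trans cv _; apply: ordmod_leD => //; exact: le_trans va ab.
Qed.

(** A supremum of a finite net of mesh [e] satisfies this; unlike being such a
    supremum, it mentions no net, so one approximation can be refined without
    remembering how it was built. *)
Definition dominates_upto A (e : R) s : Prop :=
  forall a, A a -> exists w, [/\ F w, p w <= e & a <= s + w].

(** Adjoin a net of mesh [d] to [s]: the points of the net already lie below [s]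
    up to errors of norm at most [e], so [s] moves by at most [e]. *)
Lemma dominates_upto_refine A (K d e : R) s :
  A `<=` F -> (forall a, A a -> 0 <= a /\ p a <= K) ->
  totally_bounded_on F p A -> 0 < d -> 0 <= e ->
  [/\ F s, 0 <= s, p s <= K & dominates_upto A e s] ->
  exists s', [/\ F s', 0 <= s', p s' <= K & dominates_upto A d s'] /\
    p (s' - s) <= e.
Proof.
move=> AF AK tbA d0 e0 [Fs s0 psK sA].
have [l [lA Al]] := totally_bounded_net AF tbA d0.
have [|s' [[Fs' ss' ps' ls'] [w [Fw w0 pw s'w]]]] :=
    am_finite_majorant (l := l) Fs s0 psK e0.
  move=> c /lA Ac; have [c0 cK] := AK c Ac.
  by split=> //; [exact: AF|exact: sA].
exists s'; split; first split=> //; first exact: le_trans ss'.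
  move=> a Aa; have [c /[dup] cl /lA Ac ac] := Al a Aa.
  exists (a - c); split=> //; first by apply: (bl_sub FpB); exact: AF.
  by rewrite -[leLHS](subrKC c); apply: ordmod_leD => //; exact: ls'.
apply: le_trans pw; apply: (bl_norm_le FpB) => //; first exact: (bl_sub FpB).
  by rewrite ordmod_lerBlDr addrC.
by rewrite opprB; apply: le_trans w0; rewrite -ordmod_leN2 oppr0 opprB ordmod_subr_ge0.
Qed.

Lemma bl_geometric_limit (x_ : nat -> E) (K : R) :
  (forall n, F (x_ n)) -> (forall n, p (x_ n.+1 - x_ n) <= K / 2 ^+ n) ->
  exists2 l, F l & converges_to p x_ l.
Proof.
move=> Fx x1; have Fxx m n := bl_sub FpB (Fx m) (Fx n).
have K0 : 0 <= K.
  by have := le_trans (bl_norm_ge0 FpB (Fxx 1 0)) (x1 0); rewrite expr0 divr1.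
(* The tail of the geometric series, kept exact so that the induction closes. *)
have dist n m : p (x_ (n + m)%N - x_ n) <= 2 * K / 2 ^+ n - 2 * K / 2 ^+ (n + m)%N.
  elim: m => [|m IHm]; first by rewrite addn0 !subrr (bl_norm0 FpB).
  rewrite addnS -(subrKA (x_ (n + m)%N)).
  apply: le_trans (no_triangle (blo_norm FpB) (Fxx _ _) (Fxx _ _)) _.
  apply: le_trans (lerD (x1 _) IHm) _; rewrite exprS invfM.
  lra.
apply: (bl_limit FpB) => // e e0.
pose N := Num.bound (4 * K / e); exists N.
have Ke : 4 * K / 2 ^+ N < e.
  rewrite ltr_pdivrMr ?exprn_gt0 // [ltRHS]mulrC -ltr_pdivrMr //.
  exact: upper_nthrootP.
have distN m : (N <= m)%N -> p (x_ m - x_ N) <= 2 * K / 2 ^+ N.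
  move=> /subnKC <-; apply: le_trans (dist _ _) _.
  by rewrite gerBl mulr_ge0 ?mulr_ge0 ?invr_ge0 ?exprn_ge0.
move=> m n Nm Nn; rewrite -(subrKA (x_ N)).
apply: le_lt_trans (no_triangle (blo_norm FpB) (Fxx _ _) (Fxx _ _)) _.
rewrite (bl_distrC FpB (Fx N)) //; apply: le_lt_trans Ke.
apply: le_trans (lerD (distN m Nm) (distN n Nn)) _.
by lra.
Qed.

(** Start from 0, which dominates [A] up to [K], and refine with errors halved at
    each step; the limit dominates [A] exactly and its norm does not exceed the
    common bound [K] of the approximations. *)
Theorem am_totally_bounded_majorant A (K : R) :
  A `<=` F -> (forall a, A a -> 0 <= a /\ p a <= K) ->
  totally_bounded_on F p A -> 0 < K ->
  exists u, [/\ F u, p u <= K & forall a, A a -> a <= u].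
Proof.
move=> AF AK tbA K0.
have k0 n : 0 < K / 2 ^+ n by rewrite divr_gt0 ?exprn_gt0.
pose good n s := [/\ F s, 0 <= s, p s <= K & dominates_upto A (K / 2 ^+ n) s].
have [f fP] : {f : nat * E -> E & forall ns, good ns.1 ns.2 ->
    good ns.1.+1 (f ns) /\ p (f ns - ns.2) <= K / 2 ^+ ns.1}.
  apply: (@choice _ _ (fun ns s' => good ns.1 ns.2 ->
    good ns.1.+1 s' /\ p (s' - ns.2) <= K / 2 ^+ ns.1)) => -[n s] /=.
  have [gs|ngs] := pselect (good n s); last by exists 0.
  have [s' s'P] := dominates_upto_refine AF AK tbA (k0 n.+1) (ltW (k0 n)) gs.
  by exists s'.
pose x_ := fix x n := if n is n'.+1 then f (n', x n') else 0.
have xgood n : good n (x_ n).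
  elim: n => [|n IHn]; last exact: (fP (n, x_ n) IHn).1.
  split=> //; rewrite ?(bl_norm0 FpB) ?(ltW K0) //.
    exact: rso_zero (blo_riesz FpB).
  move=> a Aa; exists a; split; rewrite ?add0r ?expr0 ?divr1 //; first exact: AF.
  exact: (AK a Aa).2.
have Fx n : F (x_ n) by case: (xgood n).
have [|u Fu xu] := @bl_geometric_limit x_ K Fx.
  by move=> n; exact: (fP (n, x_ n) (xgood n)).2.
exists u; split=> //.
  apply/ler_addgt0Pr => e /xu[N /(_ _ (leqnn N)) xNu].
  have [_ _ pxK _] := xgood N.
  rewrite -(subrKC (x_ N) u) -opprB.
  have FxNu := bl_sub FpB (Fx N) Fu.
  apply: le_trans (no_triangle (blo_norm FpB) (Fx N) (bl_opp FpB FxNu)) _.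
  by rewrite (bl_normN FpB) // lerD.
move=> a Aa; rewrite -ordmod_subr_ge0 -ordmod_leN2 oppr0 opprB.
apply: (bl_le0_approx FpB); first by apply: (bl_sub FpB) => //; exact: AF.
move=> e e0; have e20 : 0 < e / 2 by lra.
have [N xNu] := xu _ e20; pose n := maxn N (Num.bound (K / (e / 2))).
have [_ _ _ /(_ a Aa)[w [Fw pw aw]]] := xgood n.
have FxNu := bl_sub FpB (Fx n) Fu.
exists (w + (x_ n - u)); split; first exact: (bl_add FpB).
  by rewrite addrA [w + _]addrC; exact: ordmod_leD.
apply: le_trans (no_triangle (blo_norm FpB) Fw FxNu) _.
have Ke : K / 2 ^+ n < e / 2.
  rewrite ltr_pdivrMr ?exprn_gt0 // [ltRHS]mulrC -ltr_pdivrMr //.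
  by apply: upper_nthrootP; exact: leq_maxr.
have := xNu n (leq_maxl _ _); lra.
Qed.

End TotallyBoundedSets.

(** * The cone and the norm generated by a positive subset *)
Section GeneratedNorm.
Context {R : realType} {E : orderedLmodType R}.
Variable M : set E.
Hypothesis M_positive : positive_subset M.
Implicit Types (v c u : E) (T : R).

(** The coefficient sum [T] is recorded because p_M is an infimum of such sums. *)
Definition combination T c : Prop :=
  exists (n : nat) (t : 'I_n -> R) (m : 'I_n -> E),
    [/\ forall j, 0 <= t j, forall j, M (m j), c = \sum_(j < n) t j *: m j
      & T = \sum_(j < n) t j].

Lemma combination_ge0 T c : combination T c -> 0 <= T.
Proof. by move=> [n [t [m [t0 _ _ ->]]]]; exact: sumr_ge0. Qed.

Lemma combination1 m : M m -> combination 1 m.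
Proof.
move=> Mm; exists 1%N, (fun=> 1), (fun=> m).
by split; rewrite ?big_ord1 ?scale1r.
Qed.

Lemma combination_scale t T c : 0 <= t ->
  combination T c -> combination (t * T) (t *: c).
Proof.
move=> t0 [n [s [m [s0 Mm -> ->]]]].
exists n, (fun j => t * s j), m; split=> // [j||]; first exact: mulr_ge0.
  by rewrite scaler_sumr; apply: eq_bigr => j _; rewrite scalerA.
by rewrite mulr_sumr.
Qed.

(** Dividing a combination by its coefficient sum gives a point of the convex
    hull, which is nonzero since the hull avoids 0; when the sum vanishes, so does
    the combination, and any generator serves as the point of the hull. *)
Lemma generated_coneP c : generated_cone M c <-> exists T, combination T c.
Proof.
have [[m0 Mm0] _ M0] := M_positive; split.
  move=> [a [m [a0 [n [t [x [t0 t1 Mx ->]]]] _ ->]]].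
  by exists (a * 1); apply: combination_scale => //; exists n, t, x.
move=> [T /[dup] /combination_ge0 T0 [n [t [x [t0 Mx -> TE]]]]].
have hull_neq0 m : convex_hull M m -> m <> 0 by move=> /[swap] ->.
have [T0'|Tn0] := eqVneq T 0.
  have tE j : t j = 0.
    move: (T0'); rewrite TE => /eqP; rewrite psumr_eq0 // => /allP /(_ j).
    by rewrite mem_index_enum => /(_ isT) /eqP.
  have Mhull : convex_hull M m0.
    by exists 1%N, (fun=> 1), (fun=> m0); split; rewrite ?big_ord1 ?scale1r.
  exists 0, m0; split=> //; first exact: hull_neq0.
  by rewrite scale0r big1 // => j _; rewrite tE scale0r.
have hull : convex_hull M (\sum_(j < n) (T^-1 * t j) *: x j).
  exists n, (fun j => T^-1 * t j), x; split=> // [j|].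
    by rewrite mulr_ge0 ?invr_ge0.
  by rewrite -mulr_sumr -TE mulVf.
exists T, (\sum_(j < n) (T^-1 * t j) *: x j); split=> //; first exact: hull_neq0.
by rewrite scaler_sumr; apply: eq_bigr => j _; rewrite scalerA mulrA divff ?mul1r.
Qed.

Lemma generated_spaceP v : generated_space M v <->
  exists T c, [/\ combination T c, v <= c & - v <= c].
Proof.
split=> [[c /generated_coneP[T Tc] [vc Nvc]]|[T [c [Tc vc Nvc]]]].
  by exists T, c.
by exists c => //; apply/generated_coneP; exists T.
Qed.

Lemma generated_norm_le T c v : combination T c -> v <= c -> - v <= c ->
  generated_norm M v <= T.
Proof.
move=> [n [t [m [t0 Mm -> ->]]]] vc Nvc; apply: ge_inf.
  by exists 0 => _ [k [s [x [s0 _ _ _ ->]]]]; exact: sumr_ge0.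
by exists n, t, m.
Qed.

Lemma le_generated_norm (r : R) v : generated_space M v ->
  (forall T c, combination T c -> v <= c -> - v <= c -> r <= T) ->
  r <= generated_norm M v.
Proof.
move=> /generated_spaceP[T [c [[n [t [m [t0 Mm cE TE]]]] vc Nvc]]] rT.
apply: lb_le_inf.
  by exists T, n, t, m; split=> //; rewrite -cE.
move=> _ [k [s [x [s0 Mx vx Nvx ->]]]].
by apply: (rT _ (\sum_(j < k) s j *: x j)) => //; exists k, s, x.
Qed.

Lemma generator_norm_le1 m : M m -> generated_space M m /\ generated_norm M m <= 1.
Proof.
move=> Mm; have [_ Mge0 _] := M_positive; have m0 := Mge0 m Mm.
have Nmm := ordmod_opp_le m0.
have Mm1 := combination1 Mm; split; last exact: generated_norm_le Mm1 _ Nmm.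
by apply/generated_spaceP; exists 1, m.
Qed.

Lemma combination_le_scale T c u : (forall m, M m -> m <= u) ->
  combination T c -> c <= T *: u.
Proof.
move=> Mu [n [t [m [t0 Mm -> ->]]]]; rewrite scaler_suml.
by apply: ordmod_sum_le => j; apply: ordmod_leZ2l => //; exact: Mu.
Qed.

Lemma generator_exists_neq0 : exists2 m, M m & m <> 0.
Proof.
have [[m Mm] _ M0] := M_positive; exists m => // m0; apply: M0.
exists 1%N, (fun=> 1), (fun=> m).
by split; rewrite ?big_ord1 ?scale1r.
Qed.

(** If |v| <= sum_j t_j m_j then normE v <= B * sum_j t_j, where [B] bounds the
    norms of the generators. *)
Lemma norm_le_generated_norm (normE : E -> R) :
  banach_lattice_on [set: E] normE -> uniformly_bounded normE M ->
  exists2 B : R, 0 < B &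
    forall v, generated_space M v -> normE v <= B * generated_norm M v.
Proof.
move=> EB [b bub]; have [_ Mge0 _] := M_positive.
(* The maximum with 1 makes the bound positive, so that one can divide by it. *)
pose B := Num.max 1 b; have B0 : 0 < B by rewrite lt_max ltr01.
exists B => // v Mv; rewrite mulrC -ler_pdivrMr //.
apply: le_generated_norm => // T c [n [t [m [t0 Mm -> ->]]]] vc Nvc.
rewrite ler_pdivrMr //; apply: le_trans (bl_norm_le EB _ _ vc Nvc) _ => //.
rewrite mulr_suml.
apply: (big_ind2 (fun x r => normE x <= r)) => [|x r y s xr ys|j _].
- by rewrite (bl_norm0 EB).
- apply: le_trans (no_triangle (blo_norm EB) _ _) _ => //; exact: lerD.
- rewrite (no_homogeneous (blo_norm EB)) // ger0_norm // ler_wpM2l //.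
  by rewrite le_max bub ?orbT //; exists (m j).
Qed.

End GeneratedNorm.

(** * Principal ideals with their order unit norms *)
Section OrderUnitNorm.
Context {R : realType} {E : orderedLmodType R} {normE : E -> R}.
Hypothesis EB : banach_lattice_on [set: E] normE.
Variable u : E.
Hypothesis u_gt0 : 0 < u.
Implicit Types (v x y : E) (t : R).
Let u0 : 0 <= u := ltW u_gt0.
Let un0 : u <> 0.
Proof. by move=> uE; move: u_gt0; rewrite uE ltxx. Qed.

Lemma convex_hull_singleton v : convex_hull [set u] v <-> v = u.
Proof.
split=> [[n [t [m [t0 t1 mu ->]]]]|->].
  by rewrite (eq_bigr (fun j => t j *: u)) -?scaler_suml ?t1 ?scale1r // => j _; rewrite mu.
by exists 1%N, (fun=> 1), (fun=> u); split; rewrite ?big_ord1 ?scale1r.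
Qed.

Lemma principal_idealP v :
  principal_ideal u v <-> exists t, [/\ 0 <= t, v <= t *: u & - v <= t *: u].
Proof.
split=> [[_ [t [m [t0 /convex_hull_singleton -> _ ->]]] [vt Nvt]]|[t [t0 vt Nvt]]].
  by exists t.
exists (t *: u) => //; exists t, u; split=> //.
exact/convex_hull_singleton.
Qed.

Lemma order_unit_norm_ge0 v : 0 <= order_unit_norm u v.
Proof.
rewrite /order_unit_norm; set A := [set _ | _].
have [->|/set0P A0] := eqVneq A set0; first by rewrite inf0.
by apply: lb_le_inf => // t [].
Qed.

Lemma order_unit_norm_le {v t} : 0 <= t -> v <= t *: u -> - v <= t *: u ->
  order_unit_norm u v <= t.
Proof. by move=> t0 vt Nvt; apply: ge_inf => //; exists 0 => s []. Qed.

Lemma le_order_unit_norm v (r : R) : principal_ideal u v ->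
  (forall t, 0 <= t -> v <= t *: u -> - v <= t *: u -> r <= t) ->
  r <= order_unit_norm u v.
Proof.
move=> /principal_idealP[t tP] rt; apply: lb_le_inf; first by exists t.
by move=> s [s0 vs Nvs]; exact: rt.
Qed.

(** [v] lies below every multiple [(N + e) *: u] with [e] positive, hence below
    [N *: u], because the order of a Banach lattice is Archimedean. *)
Lemma order_unit_norm_attained v : principal_ideal u v ->
  v <= order_unit_norm u v *: u /\ - v <= order_unit_norm u v *: u.
Proof.
move=> /principal_idealP[t tP]; set N := order_unit_norm u v.
have approx (e : R) : 0 < e -> v <= (N + e) *: u /\ - v <= (N + e) *: u.
  move=> e0; pose A := [set s : R | [/\ 0 <= s, v <= s *: u & - v <= s *: u]].
  have Ainf : has_inf A by split; [exists t|exists 0 => s []].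
  have [s [s0 vs Nvs] sN] := inf_adherent e0 Ainf.
  by split; [apply: le_trans vs _|apply: le_trans Nvs _];
    apply: ordmod_leZ2r => //; exact: ltW sN.
have arch x : (forall e : R, 0 < e -> x <= (N + e) *: u) -> x <= N *: u.
  move=> xN; rewrite -ordmod_subr_ge0 -ordmod_leN2 oppr0 opprB.
  apply: (bl_archimedean EB (u := u)) => // e e0.
  by rewrite ordmod_lerBlDr -scalerDl addrC xN.
by split; apply: arch => e /approx[].
Qed.

Lemma principal_ideal_between v a b : principal_ideal u a -> principal_ideal u b ->
  a <= v -> v <= b -> principal_ideal u v.
Proof.
move=> /principal_idealP[s [s0 _ Nas]] /principal_idealP[t [t0 bt _]] av vb.
apply/principal_idealP; exists (s + t); split; rewrite ?addr_ge0 //.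
  by apply: le_trans vb (le_trans bt _); apply: ordmod_leZ2r; rewrite ?lerDr.
apply: (@le_trans _ _ (- a)); first by rewrite ordmod_leN2.
by apply: le_trans Nas _; apply: ordmod_leZ2r; rewrite ?lerDl.
Qed.

Lemma principal_ideal_linear (a : R) x y :
  principal_ideal u x -> principal_ideal u y -> principal_ideal u (a *: x + y).
Proof.
have scale_pos b z : 0 <= b -> principal_ideal u z -> principal_ideal u (b *: z).
  move=> b0 /principal_idealP[t [t0 zt Nzt]]; apply/principal_idealP.
  exists (b * t); rewrite mulr_ge0 // -scalerN -scalerA.
  by split=> //; exact: ordmod_leZ2l.
have opp z : principal_ideal u z -> principal_ideal u (- z).
  move=> /principal_idealP[t [t0 zt Nzt]]; apply/principal_idealP.
  by exists t; rewrite opprK.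
move=> ux /principal_idealP[s [s0 ys Nys]].
have /principal_idealP[t [t0 xt Nxt]] : principal_ideal u (a *: x).
  have [a0|a0] := leP 0 a; first exact: scale_pos.
  by rewrite -[a]opprK scaleNr; apply/opp/scale_pos => //; lra.
apply/principal_idealP; exists (t + s); rewrite addr_ge0 // opprD scalerDl.
by split=> //; exact: ordmod_leD.
Qed.

Lemma principal_ideal_scale_unit t : 0 <= t -> principal_ideal u (t *: u).
Proof.
move=> t0; apply/principal_idealP; exists t; split=> //.
by apply: ordmod_opp_le; exact: ordmod_scale_ge0.
Qed.

(** The ideal is order convex, so it contains the joins formed in [E]. *)
Lemma riesz_space_principal_ideal : riesz_space_on (principal_ideal u).
Proof.
split.
- by rewrite -(scale0r u); exact: principal_ideal_scale_unit.
- exact: principal_ideal_linear.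
move=> x y ux uy; have [s [_ xs ys smin]] := rso_join (blo_riesz EB) (x := x) (y := y) I I.
exists s; split=> // [|z _]; last exact: smin.
have /principal_idealP[a [a0 xa _]] := ux; have /principal_idealP[b [b0 yb _]] := uy.
apply: principal_ideal_between ux (principal_ideal_scale_unit (addr_ge0 a0 b0)) xs _.
apply: smin => //.
  by apply: le_trans xa _; apply: ordmod_leZ2r; rewrite ?lerDl.
by apply: le_trans yb _; apply: ordmod_leZ2r; rewrite ?lerDr.
Qed.

Lemma order_unit_norm_monotone x y : principal_ideal u y ->
  0 <= x -> x <= y -> order_unit_norm u x <= order_unit_norm u y.
Proof.
move=> uy x0 xy; have [yN _] := order_unit_norm_attained uy.
have xN := le_trans xy yN.
apply: order_unit_norm_le => //; first exact: order_unit_norm_ge0.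
exact: le_trans (ordmod_opp_le x0) xN.
Qed.

Lemma norm_on_order_unit_norm : norm_on (principal_ideal u) (order_unit_norm u).
Proof.
have N0 := order_unit_norm_ge0; split=> [x y ux uy|a x ux|x ux Nx0].
- have [xN NxN] := order_unit_norm_attained ux.
  have [yN NyN] := order_unit_norm_attained uy.
  apply: order_unit_norm_le; rewrite ?addr_ge0 // ?opprD scalerDl; exact: ordmod_leD.
- have scale_le b z : principal_ideal u z ->
      order_unit_norm u (b *: z) <= `|b| * order_unit_norm u z.
    move=> /order_unit_norm_attained[zN NzN].
    apply: order_unit_norm_le; rewrite ?mulr_ge0 // -scalerA.
      have [b0|b0] := ger0P b; first exact: ordmod_leZ2l.
      by rewrite -[X in X *: z]opprK scaleNr -scalerN; apply: ordmod_leZ2l => //; lra.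
    have [b0|b0] := ger0P b; first by rewrite -scalerN; apply: ordmod_leZ2l.
    by rewrite -scaleNr; apply: ordmod_leZ2l => //; lra.
  (* The reverse inequality is [scale_le] for the inverse scalar. *)
  apply/eqP; rewrite eq_le scale_le //=.
  have [->|a0] := eqVneq a 0; first by rewrite normr0 mul0r N0.
  have uax : principal_ideal u (a *: x).
    rewrite -[_ *: x]addr0; apply: principal_ideal_linear => //.
    exact: rso_zero riesz_space_principal_ideal.
  have := scale_le a^-1 _ uax; rewrite scalerA mulVf // scale1r normfV.
  by rewrite -ler_pdivrMl ?invr_gt0 ?normr_gt0 // invrK.
- have := order_unit_norm_attained ux; rewrite Nx0 scale0r => -[x_le0 Nx_le0].
  by apply/eqP; rewrite eq_le x_le0 -ordmod_leN2 oppr0.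
Qed.

(** The order unit norm dominates a multiple of [normE], so a Cauchy sequence
    converges in [E]; the Cauchy estimates are order bounds, which survive the
    limit in the second index and become estimates for the distance to it. *)
Lemma complete_order_unit_norm : complete_on (principal_ideal u) (order_unit_norm u).
Proof.
move=> x_ ux cx.
have uxx m n : principal_ideal u (x_ m - x_ n).
  by rewrite addrC -scaleN1r; exact: principal_ideal_linear.
have [|l _ xl] := bl_limit EB (x_ := x_) (fun=> I).
  move=> e e0; have nu0 := bl_norm_ge0 EB (x := u) I.
  have d0 : 0 < normE u + 1 by lra.
  have [N NP] := cx _ (divr_gt0 e0 d0); exists N => m n Nm Nn.
  have [d1 d2] := order_unit_norm_attained (uxx m n).
  apply: le_lt_trans (bl_norm_le EB (w := _ *: u) I I d1 d2) _.
  rewrite (no_homogeneous (blo_norm EB)) // (ger0_norm (order_unit_norm_ge0 _)).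
  have := NP m n Nm Nn; rewrite ltr_pdivlMr //; apply: le_lt_trans.
  by apply: ler_wpM2l; [exact: order_unit_norm_ge0|lra].
have close (e : R) : 0 < e -> exists N, forall m, (N <= m)%N ->
    x_ m - l <= e *: u /\ - (x_ m - l) <= e *: u.
  move=> e0; have [N NP] := cx e e0; exists N => m Nm.
  have xx i j : (N <= i)%N -> (N <= j)%N -> x_ i - x_ j <= e *: u.
    move=> Ni Nj; have [+ _] := order_unit_norm_attained (uxx i j).
    by move/le_trans; apply; apply: ordmod_leZ2r => //; exact: ltW (NP _ _ Ni Nj).
  rewrite opprB !ordmod_lerBlDr; split.
    rewrite addrC -ordmod_lerBlDr.
    apply: (bl_limit_ge EB (N := N) _ _ _ xl) => // n Nn.
    by rewrite ordmod_lerBlDr addrC -[leLHS](subrK (x_ n)); apply: ordmod_leD => //; exact: xx.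
  apply: (bl_limit_le EB (N := N) _ _ _ xl) => // n Nn.
  by rewrite -[leLHS](subrK (x_ m)); apply: ordmod_leD => //; exact: xx.
have ul : principal_ideal u l.
  have [N NP] := close 1 ltr01; have [d1 d2] := NP N (leqnn N).
  rewrite -(subKr (x_ N) l) addrC -scaleN1r; apply: principal_ideal_linear => //.
  by apply/principal_idealP; exists 1.
exists l => //; apply/cvgr0Pnorm_le => e e0; have [N NP] := close e e0.
exists N => // m /= Nm; rewrite (ger0_norm (order_unit_norm_ge0 _)).
have [d1 d2] := NP m Nm; exact: order_unit_norm_le (ltW e0) d1 d2.
Qed.

Lemma am_space_order_unit_norm : am_space_on (principal_ideal u) (order_unit_norm u).
Proof.
have NP x : principal_ideal u x -> principal_ideal u (order_unit_norm u x *: u).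
  by move=> _; apply/principal_ideal_scale_unit/order_unit_norm_ge0.
split; first split.
- exact: riesz_space_principal_ideal.
- exact: norm_on_order_unit_norm.
- by move=> x y _ uy; exact: order_unit_norm_monotone.
- move=> x s ux [us xs Nxs smin].
  have [sN _] := order_unit_norm_attained us.
  have [xN NxN] := order_unit_norm_attained ux.
  have s0 := ordmod_majorant_ge0 xs Nxs.
  have N0 := order_unit_norm_ge0.
  apply/eqP; rewrite eq_le; apply/andP; split; apply: order_unit_norm_le => //.
  + by apply: smin => //; exact: NP.
  + by apply: le_trans (ordmod_opp_le s0) _; exact: smin (NP _ ux) xN NxN.
  + exact: le_trans sN.
  + exact: le_trans sN.
- exact: complete_order_unit_norm.
move=> x y s ux uy x0 y0 [us xs ys smin].
apply/eqP; rewrite eq_le ge_max !order_unit_norm_monotone ?andbT //.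
have N0 := order_unit_norm_ge0.
set k := Num.max _ _; have k0 : 0 <= k by rewrite le_max N0.
have sk : s <= k *: u.
  apply: smin; first exact: principal_ideal_scale_unit.
    have [xN _] := order_unit_norm_attained ux; apply: le_trans xN _.
    by apply: ordmod_leZ2r; rewrite ?le_max ?lexx.
  have [yN _] := order_unit_norm_attained uy; apply: le_trans yN _.
  by apply: ordmod_leZ2r; rewrite ?le_max ?lexx ?orbT.
apply: order_unit_norm_le => //.
by apply: le_trans (ordmod_opp_le _) sk; exact: le_trans xs.
Qed.

End OrderUnitNorm.

(** * Comparing the generated norm with an order unit norm *)
Section UpperBoundOfGenerators.
Context {R : realType} {E : orderedLmodType R} {M : set E}.
Hypothesis M_positive : positive_subset M.
Variable u : E.
Hypotheses (u_gt0 : 0 < u) (M_le_u : forall m, M m -> m <= u).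

Lemma generated_space_principal :
  generated_space M u -> generated_space M = principal_ideal u.
Proof.
move=> /(generated_spaceP M_positive)[T0 [c0 [Tc0 uc0 _]]].
apply/seteqP; split=> v.
  move=> /(generated_spaceP M_positive)[T [c [Tc vc Nvc]]].
  have cu := combination_le_scale M_le_u Tc.
  apply/(principal_idealP u_gt0); exists T; split; first exact: combination_ge0 Tc.
    exact: le_trans cu.
  exact: le_trans cu.
move=> /(principal_idealP u_gt0)[t [t0 vt Nvt]].
have tuc : t *: u <= t *: c0 by exact: ordmod_leZ2l.
apply/(generated_spaceP M_positive); exists (t * T0), (t *: c0); split.
- exact: combination_scale.
- exact: le_trans tuc.
- exact: le_trans tuc.
Qed.

Lemma order_unit_norm_le_generated v :
  generated_space M v -> order_unit_norm u v <= generated_norm M v.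
Proof.
move=> Mv; apply: (le_generated_norm M_positive) => // T c Tc vc Nvc.
have cu := combination_le_scale M_le_u Tc.
apply: order_unit_norm_le; first exact: combination_ge0 Tc.
  exact: le_trans cu.
exact: le_trans cu.
Qed.

End UpperBoundOfGenerators.

Lemma am_space_scale {R : realType} {E : orderedLmodType R} (F : set E)
    (p q : E -> R) (k : R) :
  0 < k -> (forall x, F x -> p x = k * q x) -> am_space_on F q -> am_space_on F p.
Proof.
move=> k0 pE Fq; have qB := am_banach_lattice Fq.
have [Fr [tri hom def] mon ab co] := qB.
have k_ge0 := ltW k0.
split; first split=> //.
- split=> [x y Fx Fy|a x Fx|x Fx].
  + rewrite !pE //; last exact: (bl_add qB).
    by rewrite -mulrDr ler_pM2l // tri.
  + by rewrite !pE ?hom 1?mulrCA //; exact: (bl_scale qB).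
  + by rewrite pE // => /eqP; rewrite mulf_eq0 gt_eqF //= => /eqP; exact: def.
- by move=> x y Fx Fy x0 xy; rewrite !pE // ler_pM2l // mon.
- by move=> x s Fx js; rewrite !pE ?(ab x s Fx js) //; case: js.
- move=> x_ Fx cx; have [|l Fl xl] := co x_ Fx.
    move=> e e0; have [N NP] := cx _ (mulr_gt0 k0 e0); exists N => m n Nm Nn.
    by have := NP m n Nm Nn; rewrite pE ?ltr_pM2l //; exact: (bl_sub qB).
  exists l => //; rewrite -(mulr0 k).
  rewrite (_ : (fun n => p (x_ n - l)) = (fun n => k * q (x_ n - l))).
    by apply: cvgM => //; exact: cvg_cst.
  by apply/funext => n; rewrite pE //; exact: (bl_sub qB).
move=> x y s Fx Fy x0 y0 js; rewrite !pE //; last by case: js.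
by rewrite (am_max Fq Fx Fy x0 y0 js) maxr_pMr.
Qed.

Unset Implicit Arguments.

Theorem proposition10 (R : realType) (E : orderedLmodType R) (normE : E -> R)
    (E_banach_lattice : banach_lattice_on [set: E] normE)
    (M : set E)
    (M_positive : positive_subset M)
    (M_bounded : uniformly_bounded normE M)
    (M_totally_bounded :
      totally_bounded_on (generated_space M) (generated_norm M) M) :
  (am_space_on (generated_space M) (generated_norm M) /\
     exists e : E, is_order_unit_on (generated_space M) e)
  <->
  (exists u : E,
     [/\ generated_space M u, 0 < u,
         generated_space M = principal_ideal u
       & forall v, generated_space M v ->
           generated_norm M v =
             1 / generated_norm M u * order_unit_norm u v]).
Proof.
have [_ Mge0 _] := M_positive.
split=> [[MAM _]|[u [Mu u_gt0 MuE normE_u]]].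
  have MB := am_banach_lattice MAM.
  have [||u [Mu pu1 Mleu]] := am_totally_bounded_majorant MAM _ _ M_totally_bounded ltr01.
  - by move=> m /(generator_norm_le1 M_positive)[].
  - by move=> m Mm; split; [exact: Mge0|exact: (generator_norm_le1 M_positive Mm).2].
  have u0 : 0 < u.
    have [m Mm mn0] := generator_exists_neq0 M_positive.
    have m0 : 0 < m by rewrite lt_neqAle Mge0 // andbT eq_sym; exact/eqP.
    exact: lt_le_trans m0 (Mleu m Mm).
  have MuE := generated_space_principal M_positive u0 Mleu Mu.
  have lower := order_unit_norm_le_generated M_positive Mleu.
  have upper v : generated_space M v ->
      generated_norm M v <= generated_norm M u * order_unit_norm u v.
    move=> Mv; have uv : principal_ideal u v by rewrite -MuE.
    have [vN NvN] := order_unit_norm_attained E_banach_lattice u0 uv.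
    have MNu := bl_scale MB (order_unit_norm u v) Mu.
    apply: le_trans (bl_norm_le MB Mv MNu vN NvN) _.
    by rewrite (no_homogeneous (blo_norm MB)) // ger0_norm ?order_unit_norm_ge0 // mulrC.
  have pu0 := bl_norm_gt0 MB Mu u0.
  (* At u itself: p u <= p u * ||u||_u <= ||u||_u <= p u, with p u > 0. *)
  have pu : generated_norm M u = 1.
    have := lower u Mu; have := upper u Mu; nra.
  exists u; split=> // v Mv; rewrite pu divr1 mul1r.
  apply/eqP; rewrite eq_le lower // andbT.
  by have := upper v Mv; rewrite pu mul1r.
have k0 : 0 < 1 / generated_norm M u.
  have [B B0 BP] := norm_le_generated_norm M_positive E_banach_lattice M_bounded.
  have nu := bl_norm_gt0 E_banach_lattice I u_gt0.
  rewrite divr_gt0 // -(pmulr_rgt0 _ B0); exact: lt_le_trans nu (BP u Mu).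
split.
  apply: (am_space_scale k0 normE_u); rewrite MuE.
  exact: (am_space_order_unit_norm E_banach_lattice u_gt0).
exists u; split=> //; first exact: ltW.
by move=> v; rewrite MuE => /(principal_idealP u_gt0)[t [t0 vt _]]; exists t.
Qed.
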